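(* For every positive integer $n$, $$A166079(n)=n-b_{n,1}.$$
   Context: Places $1,\dots,n$ stand in a row; neighbouring places have distance $1$. At any time at which at least one place is occupied, the distance of an empty place $x$ is $\min|x-y|$ over all occupied places $y$. Persons arrive one after another and each occupies one empty place. Politeness rule: every person except the first occupies one of the empty places whose distance is maximal among all empty places at that time. $A166079(n)$ is the number of persons who can take one of $n$ initially empty places in a row, assuming that the first person takes a place at an end of the row, that every later person obeys the politeness rule, and that nobody takes a place neighbouring an occupied one (the process stops when every empty place has distance $1$ or no place is empty). $b_{n,1}$ is the number of persons (the first person is not counted) who, at the moment of choosing, occupy a place of distance exactly $1$, when $n$ persons fill all $n$ places according to the politeness rule (without the prohibition on neighbouring places) and the first person takes the leftmost place. These numbers do not depend on the choices made. *)

(* Defs.v *)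
From mathcomp Require Import all_boot all_order all_algebra.
Set Implicit Arguments.
Unset Strict Implicit.
Unset Printing Implicit Defensive.

(* The places are the elements of 'I_n, from left to right.  A course of      *)
(* events is given by the place x of the first person and the list s of the   *)
(* places taken by the later persons in order of arrival.                     *)

(* The default value n of the minimum exceeds every distance in the row, so   *)
(* it has no influence as soon as occ is nonempty.                            *)
Definition place_dist n (occ : seq 'I_n) (x : 'I_n) : nat :=
  \big[minn/n]_(y <- occ) `|x - y|%N.

Definition polite_choice n (occ : seq 'I_n) (x : 'I_n) : bool :=
  (x \notin occ) &&
  [forall z, (z \notin occ) ==> (place_dist occ z <= place_dist occ x)].

Fixpoint polite_run n (occ s : seq 'I_n) : bool :=
  if s is x :: s' then polite_choice occ x && polite_run (x :: occ) s'
  else true.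

(* The distances of the places of s, each at the moment when it is chosen.    *)
Fixpoint chosen_dists n (occ s : seq 'I_n) : seq nat :=
  if s is x :: s' then place_dist occ x :: chosen_dists (x :: occ) s'
  else [::].

(* The last condition says that the process has stopped: every place that is  *)
(* still empty (if there is any) has distance 1.                              *)
Definition distanced_run n (x : 'I_n) (s : seq 'I_n) : bool :=
  [&& (x == 0 :> nat) || (x == n.-1 :> nat),
      polite_run [:: x] s,
      all (fun d => d != 1) (chosen_dists [:: x] s)
    & [forall z, (z \notin x :: s) ==> (place_dist (x :: s) z == 1)]].

Definition filling_run n (x : 'I_n) (s : seq 'I_n) : bool :=
  [&& x == 0 :> nat, polite_run [:: x] s & size (x :: s) == n].

(* Both numbers are described by their defining relation to n: a is their     *)
(* value if a run exists and every run, whatever the choices, yields a.       *)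
Definition is_A166079 (n a : nat) : Prop :=
  (exists (x : 'I_n) (s : seq 'I_n), distanced_run x s) /\
  (forall (x : 'I_n) (s : seq 'I_n), distanced_run x s -> size (x :: s) = a).

Definition is_b (n k b : nat) : Prop :=
  (exists (x : 'I_n) (s : seq 'I_n), filling_run x s) /\
  (forall (x : 'I_n) (s : seq 'I_n),
     filling_run x s -> count_mem k (chosen_dists [:: x] s) = b).

(* Main.v *)
(* As long as somebody is seated, the number of persons who will still choose *)
(* a place of distance at least 2 depends only on the gaps between occupied   *)
(* places: a polite choice at distance at least 2 takes the far place of an   *)
(* end gap or a middle place of an inner gap, and the two middle places of an *)
(* even gap leave the same two smaller gaps.  The sum of these numbers over   *)
(* all gaps is a potential that drops by 1 at each such choice, is unchanged  *)
(* by choices at distance 1, and vanishes when the row is full.  A distanced  *)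
(* run extends to a full polite run whose additional choices all have         *)
(* distance 1, so both quantities are determined by the initial potential.    *)

Require Import Defs.
From mathcomp Require Import all_boot all_order all_algebra.
From mathcomp Require Import zify.

(** Let e be [end_gap n.-1], the potential when a single end place is occupied ([potential_end]).
    [gap_weight_split] gives the drop inside one gap, [potential_polite] carries it over to the row
    and [potential_run] telescopes it. A full row has potential 0, so every full polite run from an
    end has exactly e choices at distance other than 1 ([full_run_count]). The remaining n-1-e later
    persons choose at distance 1, which gives b. By [stopped_run_dists], when a stopped run is
    completed politely, all e choices precede the stop, so the stopped run seats e+1 = n-b
    persons. *)

(** * Weights of single gaps *)

(** The argument [k] is fuel for the halving recursion on the gap length [g]. In a gap of at most 2
    places every place neighbours an occupied one. *)
Fixpoint inner_gap_rec (k g : nat) : nat :=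
  if k is k'.+1 then
    if g <= 2 then 0 else (inner_gap_rec k' g.-1./2 + inner_gap_rec k' g./2).+1
  else 0.

Definition inner_gap (g : nat) : nat := inner_gap_rec g g.

Definition end_gap (m : nat) : nat :=
  if m <= 1 then 0 else (inner_gap m.-1).+1.

Lemma inner_gap_rec_stable (k l g : nat) :
  g <= k -> g <= l -> inner_gap_rec k g = inner_gap_rec l g.
Proof.
elim: k l g => [|k IH] [|l] g //=.
- by case: g.
- by case: g.
- move=> gk gl; case: leqP => // g2.
  by congr (_ + _).+1; apply: IH; lia.
Qed.

Lemma inner_gapE (g : nat) :
  inner_gap g =
  if g <= 2 then 0 else (inner_gap g.-1./2 + inner_gap g./2).+1.
Proof.
rewrite {1}/inner_gap; case: g => // g /=.
case: leqP => // g2.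
by congr (_ + _).+1; apply: inner_gap_rec_stable; lia.
Qed.

Lemma inner_gap_small (g : nat) : g <= 2 -> inner_gap g = 0.
Proof. by move=> g2; rewrite inner_gapE g2. Qed.

(* The place y of 'I_n has coordinate y.+1; the coordinates 0 and n.+1 are    *)
(* sentinels beyond the two ends, so that every gap lies between two marks.   *)
Definition gap_weight (n a b : nat) : nat :=
  if (a == 0) || (b == n.+1) then end_gap (b - a).-1 else inner_gap (b - a).-1.

(** Nobody sits at a sentinel, so in an end gap only the other end counts. *)
Definition gap_dist (n a b z : nat) : nat :=
  if a == 0 then b - z else if b == n.+1 then z - a else minn (z - a) (b - z).

(** Comparing [x] with one well-chosen place of the gap, the row's end or the midpoint, pins [x]
    down up to the choice between two middle places; the recursion for the weight then applies. *)
Lemma gap_weight_split (n a b x : nat) :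
  a < x < b -> b <= n.+1 -> ~~ ((a == 0) && (b == n.+1)) ->
  (forall z, a < z < b -> gap_dist n a b z <= gap_dist n a b x) ->
  gap_weight n a b =
  (gap_dist n a b x != 1) + gap_weight n a x + gap_weight n x b.
Proof.
move=> /andP[ax xb] bn nab maxx; move: nab maxx; rewrite /gap_dist /gap_weight.
have -> : (x == 0) = false by lia.
have -> : (x == n.+1) = false by lia.
case: eqP => [a0|a0] /=.
  move=> bn1; have -> : (b == n.+1) = false by lia.
  move/(_ 1) => maxx; have x1 : x = 1 by lia.
  rewrite x1 a0 subn0 /= /end_gap /=.
  rewrite addn0; case: leqP => b1.
    by rewrite inner_gap_small //; lia.
  have -> : (b - 1 != 1) by lia.
  by congr (inner_gap _).+1; lia.
case: eqP => [b0|b0] /= _.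
  move/(_ n) => maxx; have xn : x = n by lia.
  have -> : (b - x).-1 = 0 by lia.
  rewrite {2}/end_gap /= addn0 /end_gap xn b0; case: leqP => b1.
    by rewrite inner_gap_small //; lia.
  have -> : (n - a != 1) by lia.
  by congr (inner_gap _).+1; lia.
move/(_ ((a + b)./2)) => maxx.
rewrite {1}inner_gapE; case: leqP => g2.
  have -> : minn (x - a) (b - x) = 1 by lia.
  by rewrite !inner_gap_small //; lia.
have -> : minn (x - a) (b - x) != 1 by lia.
rewrite -addnA add1n; congr _.+1.
(* The two middle places of an even gap leave the same halves in opposite orders. *)
have [[-> ->]//|[-> ->]] : ((x - a).-1 = (b - a).-1.-1./2 /\ (b - x).-1 = (b - a).-1./2)
  \/ ((x - a).-1 = (b - a).-1./2 /\ (b - x).-1 = (b - a).-1.-1./2) by lia.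
by rewrite addnC.
Qed.

(** * Distances in terms of gaps *)

Lemma distnE (x y : nat) : `|(x : int) - (y : int)|%N = (x - y) + (y - x).
Proof. lia. Qed.

(** The bound [k <= n] reflects the default value of the minimum. *)
Lemma leq_place_dist (n : nat) (occ : seq 'I_n) (x : 'I_n) (k : nat) :
  reflect (k <= n /\ forall y, y \in occ -> k <= `|x - y|%N)
          (k <= place_dist occ x).
Proof.
rewrite /place_dist; elim: occ => [|y occ IH].
  by rewrite big_nil; apply: (iffP idP) => [kn|[]].
rewrite big_cons leq_min; apply: (iffP andP) => [[ky /IH[kn ko]]|[kn ko]].
  by split=> // z; rewrite inE => /orP[/eqP->//|/ko].
split; first by apply: ko; rewrite mem_head.
by apply/IH; split=> // z zo; apply: ko; rewrite inE zo orbT.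
Qed.

Lemma place_dist_gt0 (n : nat) (occ : seq 'I_n) (x : 'I_n) :
  (0 < place_dist occ x) = (x \notin occ).
Proof.
apply/leq_place_dist/idP => [[_ d0]|xo].
  by apply/negP => /d0; rewrite distnE; lia.
split=> [|y yo]; first by have := ltn_ord x; lia.
rewrite distnE; suff : (x : nat) <> y by lia.
by move=> /val_inj xy; rewrite xy yo in xo.
Qed.

Definition marks {n : nat} (occ : seq 'I_n) : seq nat :=
  [:: 0, n.+1 & [seq y.+1 | y : 'I_n <- occ]].

Lemma marks_place (n : nat) (occ : seq 'I_n) (x : 'I_n) :
  (x.+1 \in marks occ) = (x \in occ).
Proof.
rewrite !inE /= eqSS (ltn_eqF (ltn_ord x)) /=.
by rewrite (mem_map (f := fun y : 'I_n => y.+1)) // => y z [] /val_inj.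
Qed.

Lemma marks_cons (n : nat) (occ : seq 'I_n) (x : 'I_n) (k : nat) :
  (k \in marks (x :: occ)) = (k == x.+1) || (k \in marks occ).
Proof. by rewrite !inE /=; do !case: (_ == _); rewrite ?orbT. Qed.

Definition adjacent {n : nat} (occ : seq 'I_n) (a b : nat) : Prop :=
  [/\ a \in marks occ, b \in marks occ
    & forall k, a < k < b -> k \notin marks occ].

Lemma marks_le (n : nat) (occ : seq 'I_n) (k : nat) :
  k \in marks occ -> k <= n.+1.
Proof.
rewrite !inE => /or3P[/eqP->|/eqP->|/mapP[y _ ->]] //.
by have := ltn_ord y; rewrite /=; lia.
Qed.

Lemma adjacent_exists (n : nat) (occ : seq 'I_n) (x : 'I_n) :
  x \notin occ ->
  exists a b, a < x.+1 < b /\ adjacent occ a b.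
Proof.
move=> xo; have xn := ltn_ord x.
have exa : exists a, (a \in marks occ) && (a < x.+1) by exists 0; rewrite inE.
have exb : exists b, (b \in marks occ) && (x.+1 < b).
  by exists n.+1; rewrite !inE eqxx orbT ltnS.
case: (ex_maxnP exa (m := x)); first by move=> k /andP[].
move=> a /andP[am ax] maxa.
case: (ex_minnP exb) => b /andP[bm xb] minb.
exists a, b; split; first by rewrite ax xb.
split=> // k /andP[ak kb]; apply/negP => km.
have [kx|xk|kx] := ltngtP k x.+1.
- by have := maxa k; rewrite km kx => /(_ isT); lia.
- by have := minb k; rewrite km xk => /(_ isT); lia.
- by move: km; rewrite kx marks_place (negbTE xo).
Qed.

(** No occupied place lies strictly inside the gap, and each end that is not a sentinel is occupied,
    so the minimum is attained at an end. *)
Lemma place_dist_gap (n : nat) (occ : seq 'I_n) (a b : nat) (x : 'I_n) :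
  adjacent occ a b -> a < x.+1 < b -> ~~ ((a == 0) && (b == n.+1)) ->
  place_dist occ x = gap_dist n a b x.+1.
Proof.
move=> [am bm gap] axb nab; have xn := ltn_ord x; have bn := marks_le _ _ _ bm.
have real k : k \in marks occ -> k != 0 -> k != n.+1 ->
    exists2 y, y \in occ & k = y.+1.
  by rewrite !inE => /or3P[->|->|/mapP[y yo ->]] // *; exists y.
have far (y : 'I_n) : y \in occ -> 0 < y.+1 <= a \/ b <= y.+1 < n.+1.
  move=> yo; have := ltn_ord y; have := gap y.+1.
  rewrite marks_place yo; case: (ltnP a y.+1); case: (ltnP y.+1 b); rewrite /=;
    [move=> _ _ /(_ isT) // | lia..].
have [_ near] := leq_place_dist _ occ x _ (leqnn _).
apply/eqP; rewrite eqn_leq; apply/andP; split.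
  rewrite /gap_dist; case: eqP => a0.
    have [||y yo by1] := real b bm; [lia | lia |].
    by have := near y yo; rewrite distnE; lia.
  have [||y yo ay] := real a am; [lia | lia |].
  have := near y yo; rewrite distnE.
  case: eqP => b0; first lia.
  have [||z zo bz] := real b bm; [lia | lia |].
  by have := near z zo; rewrite distnE; lia.
apply/leq_place_dist; rewrite /gap_dist; split.
  by do !case: eqP; lia.
by move=> y /far; rewrite distnE; do !case: eqP; lia.
Qed.

(** * The potential and its change along a run *)

(** The sentinel 0 is the starting value of [pairmap], so the sorted list of marks begins at 1. *)
Definition potential {n : nat} (occ : seq 'I_n) : nat :=
  sumn (pairmap (gap_weight n) 0 [seq k <- iota 1 n.+1 | k \in marks occ]).

Lemma filter_iota_gap (P : pred nat) (a b : nat) :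
  a < b -> P b -> (forall k, a < k < b -> ~~ P k) ->
  [seq k <- iota a.+1 (b - a) | P k] = [:: b].
Proof.
move=> ab Pb gap; have -> : b - a = (b - a.+1) + 1 by lia.
rewrite iotaD filter_cat.
have -> : a.+1 + (b - a.+1) = b by lia.
rewrite /= Pb (eq_in_filter (a2 := pred0)) ?filter_pred0 // => k.
by rewrite mem_iota => kab; apply/negbTE/gap; lia.
Qed.

(** Only the term of the pair [a], [b] is replaced; the additive form avoids truncated
    subtraction. *)
Lemma potential_split (n : nat) (occ : seq 'I_n) (a b : nat) (x : 'I_n) :
  adjacent occ a b -> a < x.+1 < b ->
  potential (x :: occ) + gap_weight n a b =
  potential occ + gap_weight n a x.+1 + gap_weight n x.+1 b.
Proof.
move=> [am bm gap] /andP[ax xb]; have bn := marks_le _ _ _ bm.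
have split_iota : iota 1 n.+1 =
    iota 1 a ++ iota a.+1 (b - a) ++ iota b.+1 (n.+1 - b).
  rewrite -[in a.+1](add1n a) catA -iotaD -[in b.+1](add1n b).
  by rewrite subnKC ?(ltnW (ltn_trans ax xb)) // -iotaD subnKC.
have split_mid : iota a.+1 (b - a) =
    iota a.+1 (x.+1 - a) ++ iota x.+2 (b - x.+1).
  have -> : b - a = (x.+1 - a) + (b - x.+1) by lia.
  by rewrite iotaD; congr (_ ++ iota _ _); lia.
have midE : [seq k <- iota a.+1 (b - a) | k \in marks occ] = [:: b].
  by apply: filter_iota_gap => //; lia.
have midE' : [seq k <- iota a.+1 (b - a) | k \in marks (x :: occ)]
    = [:: x.+1; b].
  rewrite split_mid filter_cat.
  rewrite [X in X ++ _]filter_iota_gap ?[X in _ ++ X]filter_iota_gap //.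
  - by rewrite marks_cons bm orbT.
  - by move=> k kxb; rewrite marks_cons negb_or gap; lia.
  - by rewrite marks_cons eqxx.
  - by move=> k kax; rewrite marks_cons negb_or gap; lia.
have outE (s : seq nat) : (forall k, k \in s -> k != x.+1) ->
    [seq k <- s | k \in marks (x :: occ)] = [seq k <- s | k \in marks occ].
  move=> sx; apply: eq_in_filter => k ks.
  by rewrite marks_cons (negbTE (sx k ks)).
(* After the cut, [pairmap] resumes from [a]; the default 0 serves the case of the left sentinel. *)
have lastE : last 0 [seq k <- iota 1 a | k \in marks occ] = a.
  case: (posnP a) => [->//|a0].
  have -> : iota 1 a = iota 1 a.-1 ++ [:: a].
    by rewrite -{1}(subnK a0) iotaD subn1 /= add1n prednK.
  by rewrite filter_cat /= am last_cat.
rewrite /potential split_iota !filter_cat midE midE' !outE; first last.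
- by move=> k; rewrite mem_iota; lia.
- by move=> k; rewrite mem_iota; lia.
rewrite !pairmap_cat !sumn_cat lastE /=; lia.
Qed.

(** A place of maximal distance in the row is also maximal in its own gap, and [occ] being nonempty
    keeps that gap from being the whole row. *)
Lemma potential_polite (n : nat) (occ : seq 'I_n) (x : 'I_n) :
  occ != [::] -> polite_choice occ x ->
  potential occ = (place_dist occ x != 1) + potential (x :: occ).
Proof.
move=> occ0 /andP[xo /forallP maxx].
have [a [b [axb adj]]] := adjacent_exists _ _ _ xo.
have [am bm gap] := adj; have bn := marks_le _ _ _ bm.
have nab : ~~ ((a == 0) && (b == n.+1)).
  apply/negP => /andP[/eqP a0 /eqP b0].
  case: occ occ0 gap {xo maxx adj am bm} => // y occ _ /(_ y.+1).
  by rewrite a0 b0 marks_place mem_head /= ltnS ltn_ord => /(_ isT).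
have := potential_split _ _ _ _ _ adj axb.
rewrite (gap_weight_split _ _ _ _ axb bn nab); last first.
  move=> z zab; have zn : z.-1 < n by lia.
  have zE : z = (Ordinal zn).+1 by rewrite /=; lia.
  have zab' : a < (Ordinal zn).+1 < b by rewrite -zE.
  rewrite {1}zE -!(place_dist_gap _ _ _ _ _ adj) //.
  have := maxx (Ordinal zn); rewrite -marks_place -zE gap //.
by rewrite -(place_dist_gap _ _ _ _ _ adj axb nab); lia.
Qed.

Lemma potential_run (n : nat) (occ s : seq 'I_n) :
  occ != [::] -> polite_run occ s ->
  potential occ =
  count (fun d => d != 1) (chosen_dists occ s) + potential (catrev s occ).
Proof.
elim: s occ => [|x s IH] occ occ0 //= /andP[px ps].
by rewrite (potential_polite _ _ _ occ0 px) (IH _ _ ps) // addnA.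
Qed.

Lemma potential_full (n : nat) (occ : seq 'I_n) :
  (forall z, z \in occ) -> potential occ = 0.
Proof.
move=> full; rewrite /potential.
have -> : [seq k <- iota 1 n.+1 | k \in marks occ] = iota 1 n.+1.
  apply/all_filterP/allP => k; rewrite mem_iota => kn.
  have [->|kn1] := eqVneq k n.+1; first by rewrite !inE eqxx orbT.
  have k1n : k.-1 < n by lia.
  have -> : k = (Ordinal k1n).+1 by rewrite /=; lia.
  by rewrite marks_place.
suff gen m k : sumn (pairmap (gap_weight n) k (iota k.+1 m)) = 0 by [].
elim: m k => //= m IH k.
by rewrite IH /gap_weight subSnn /=; case: ifP.
Qed.

(** Split the single gap of the empty row at [x]: its weight cancels, and one of the two new gaps
    has length 0. *)
Lemma potential_end (n : nat) (x : 'I_n) :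
  (x == 0 :> nat) || (x == n.-1 :> nat) -> potential [:: x] = end_gap n.-1.
Proof.
move=> xend; have xn := ltn_ord x.
have adj : adjacent ([::] : seq 'I_n) 0 n.+1.
  by split=> [||k kn]; rewrite !inE ?eqxx ?orbT //; lia.
have axb : 0 < x.+1 < n.+1 by rewrite /=; lia.
have := potential_split _ _ _ _ _ adj axb.
have -> : potential ([::] : seq 'I_n) = gap_weight n 0 n.+1.
  rewrite /potential -[in iota _ _](subn0 n.+1) filter_iota_gap ?addn0 //=.
  - by rewrite addn0.
  - by case: adj.
  - by case: adj.
have e0 : end_gap 0 = 0 by [].
rewrite /gap_weight !eqxx !orbT /=.
case/orP: xend => /eqP xE; rewrite xE.
  by rewrite subSS !subn0 /= e0; lia.
have -> : (n.+1 - n.-1.+1).-1 = 0 by lia.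
by rewrite ?subn0 /= e0; lia.
Qed.

(** * Full runs and stopped runs *)

Lemma polite_run_cat (n : nat) (occ s t : seq 'I_n) :
  polite_run occ (s ++ t) = polite_run occ s && polite_run (catrev s occ) t.
Proof. by elim: s occ => //= x s IH occ; rewrite IH andbA. Qed.

Lemma chosen_dists_cat (n : nat) (occ s t : seq 'I_n) :
  chosen_dists occ (s ++ t) =
  chosen_dists occ s ++ chosen_dists (catrev s occ) t.
Proof. by elim: s occ => //= x s IH occ; rewrite IH. Qed.

Lemma size_chosen_dists (n : nat) (occ s : seq 'I_n) :
  size (chosen_dists occ s) = size s.
Proof. by elim: s occ => //= x s IH occ; rewrite IH. Qed.

Lemma polite_run_uniq (n : nat) (occ s : seq 'I_n) :
  uniq occ -> polite_run occ s -> uniq (catrev s occ).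
Proof.
elim: s occ => //= x s IH occ uo /andP[/andP[xo _] ps].
by apply: IH => //=; rewrite xo.
Qed.

Lemma full_seqP (n : nat) (s : seq 'I_n) :
  uniq s -> (forall z, z \in s) <-> size s = n.
Proof.
move=> us; split=> [full|sn z].
  by rewrite -(card_uniqP us) -[RHS]card_ord; apply: eq_card => z; rewrite full.
have /(uniq_min_size us) : {subset s <= enum 'I_n} by move=> y _; rewrite mem_enum.
by rewrite size_enum_ord sn leqnn => -[] // _ ->; rewrite mem_enum.
Qed.

Lemma full_run_exists (n : nat) (occ : seq 'I_n) :
  exists2 s, polite_run occ s & forall z, z \in catrev s occ.
Proof.
move: {2}(#|_|) (leqnn #|[predC occ]|) => m; elim: m occ => [|m IH] occ cm.
  exists [::] => //= z; apply: contraTT cm => zo.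
  by rewrite -ltnNge; apply/card_gt0P; exists z.
have [/existsP[z0 z0o]|/existsPn full] := boolP [exists z, z \notin occ];
  last by exists [::] => //= z; have := full z; rewrite negbK.
case: (@arg_maxnP _ z0 [predC occ] (place_dist occ) z0o) => x /= xo maxx.
have [|s ps fs] := IH (x :: occ).
  rewrite -ltnS; apply: leq_trans cm; apply: proper_card.
  apply/properP; split; last by exists x; rewrite !inE ?eqxx.
  by apply/subsetP => z; rewrite !inE negb_or => /andP[].
exists (x :: s) => //=; rewrite ps andbT /polite_choice xo /=.
by apply/forallP => z; apply/implyP => /maxx.
Qed.

(** Cut the full run before its first choice at distance 1: by politeness no empty place is then
    farther away. *)
Lemma stopped_run_exists (n : nat) (occ s : seq 'I_n) :
  polite_run occ s -> (forall z, z \in catrev s occ) ->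
  exists t, [/\ polite_run occ t,
    all (fun d => d != 1) (chosen_dists occ t)
    & forall z, z \notin catrev t occ -> place_dist (catrev t occ) z == 1].
Proof.
elim: s occ => [|x s IH] occ /=.
  by move=> _ full; exists [::]; split=> //= z; rewrite full.
case/andP=> px ps full; have [d1|d1] := eqVneq (place_dist occ x) 1.
  exists [::]; split=> //= z zo; case/andP: px => _ /forallP/(_ z).
  by rewrite zo d1 eqn_leq place_dist_gt0 zo andbT.
have [t [pt at1 st]] := IH _ ps full.
by exists (x :: t); split; rewrite //= ?px ?d1.
Qed.

(** Further arrivals can only decrease distances, and those of empty places stay positive. *)
Lemma stopped_run_dists (n : nat) (occ s : seq 'I_n) :
  (forall z, z \notin occ -> place_dist occ z == 1) -> polite_run occ s ->
  all (fun d => d == 1) (chosen_dists occ s).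
Proof.
elim: s occ => //= x s IH occ st /andP[/andP[xo _] ps].
rewrite st //=; apply: IH => // z zxo.
rewrite eqn_leq place_dist_gt0 zxo andbT.
have /st/eqP <- : z \notin occ by move: zxo; rewrite inE negb_or => /andP[].
by rewrite /place_dist big_cons geq_minr.
Qed.

(** * The values of the two numbers *)

Lemma full_run_count (n : nat) (x : 'I_n) (s : seq 'I_n) :
  (x == 0 :> nat) || (x == n.-1 :> nat) -> polite_run [:: x] s ->
  (forall z, z \in catrev s [:: x]) ->
  count (fun d => d != 1) (chosen_dists [:: x] s) = end_gap n.-1.
Proof.
move=> xend ps full; rewrite -(potential_end _ _ xend) (potential_run _ _ s) //.
by rewrite (potential_full _ _ full) addn0.
Qed.

Lemma mem_catrev1 (T : eqType) (x : T) (s : seq T) :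
  catrev s [:: x] =i x :: s.
Proof. by move=> z; rewrite catrevE mem_cat mem_rev !inE orbC. Qed.

Lemma eq_place_dist (n : nat) (occ occ' : seq 'I_n) (z : 'I_n) :
  occ =i occ' -> place_dist occ z = place_dist occ' z.
Proof.
move=> eqo; have le k : (k <= place_dist occ z) = (k <= place_dist occ' z).
  apply/leq_place_dist/leq_place_dist => -[kn ko]; split=> // y yo;
    by apply: ko; rewrite ?eqo // -eqo.
by apply/eqP; rewrite eqn_leq -le leqnn le leqnn.
Qed.

Lemma distanced_run_size (n : nat) (x : 'I_n) (s : seq 'I_n) :
  distanced_run x s -> size (x :: s) = (end_gap n.-1).+1.
Proof.
case/and4P=> xend ps as1 /forallP stop /=; congr _.+1.
(* Complete the stopped run to a full one; the added choices [t] contribute nothing to the count. *)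
have [t pt full] := full_run_exists _ (catrev s [:: x]).
have pst : polite_run [:: x] (s ++ t) by rewrite polite_run_cat ps.
rewrite -catrev_catl in full.
rewrite -(full_run_count _ _ _ xend pst full) chosen_dists_cat count_cat.
move: as1; rewrite all_count => /eqP ->; rewrite size_chosen_dists.
suff /eq_in_count -> : {in chosen_dists (catrev s [:: x]) t,
    (fun d => d != 1) =1 pred0} by rewrite count_pred0 addn0.
have /allP at1 : all (fun d => d == 1) (chosen_dists (catrev s [:: x]) t).
  apply: stopped_run_dists pt => z; rewrite mem_catrev1 => zo.
  rewrite (eq_place_dist _ _ _ _ (mem_catrev1 _ x s)).
  by have := stop z; rewrite zo.
by move=> d /at1 ->.
Qed.

(** The inequality makes the truncated subtraction exact when n-b is computed. *)
Lemma filling_run_count (n : nat) (x : 'I_n) (s : seq 'I_n) :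
  filling_run x s ->
  count_mem 1 (chosen_dists [:: x] s) = n.-1 - end_gap n.-1 /\
  end_gap n.-1 <= n.-1.
Proof.
case/and3P=> x0 ps /eqP sz.
have full : forall z, z \in catrev s [:: x].
  apply/full_seqP; first exact: polite_run_uniq ps.
  by rewrite catrevE size_cat size_rev addnC.
have := full_run_count _ _ _ _ ps full; rewrite x0 => /(_ isT).
have := count_predC (pred1 1) (chosen_dists [:: x] s).
have -> : n.-1 = size s by rewrite -[in LHS]sz.
by rewrite size_chosen_dists => <- <-; rewrite addnK leq_addl.
Qed.

Lemma distanced_run_exists (n : nat) :
  0 < n -> exists (x : 'I_n) (s : seq 'I_n), distanced_run x s.
Proof.
move=> n0; exists (Ordinal n0).
have [s ps full] := full_run_exists _ [:: Ordinal n0].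
have [t [pt at1 stop]] := stopped_run_exists _ _ _ ps full.
exists t; rewrite /distanced_run eqxx pt at1 /=.
apply/forallP => z; apply/implyP; rewrite -mem_catrev1.
rewrite -(eq_place_dist _ _ _ _ (mem_catrev1 _ _ t)).
exact: stop.
Qed.

Lemma filling_run_exists (n : nat) :
  0 < n -> exists (x : 'I_n) (s : seq 'I_n), filling_run x s.
Proof.
move=> n0; exists (Ordinal n0).
have [s ps full] := full_run_exists _ [:: Ordinal n0].
exists s; rewrite /filling_run eqxx ps /=.
have /full_seqP : uniq (catrev s [:: Ordinal n0]) by exact: polite_run_uniq ps.
by case=> /(_ full) + _; rewrite catrevE size_cat size_rev addn1 => ->.
Qed.

Theorem mainTheorem4 (n : nat) (hn : 0 < n) :
  exists a b : nat, is_A166079 n a /\ is_b n 1 b /\ a = n - b.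
Proof.
have [x [s fill]] := filling_run_exists _ hn.
have [_ le_end] := filling_run_count _ _ _ fill.
exists (end_gap n.-1).+1, (n.-1 - end_gap n.-1); split; last split; last lia.
  by split; [exact: distanced_run_exists | exact: distanced_run_size].
split; first exact: filling_run_exists.
by move=> y t /filling_run_count[].
Qed.
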